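(* Let $$\mathcal{A}=\begin{bmatrix}\alpha I_n\otimes I_m & \mathcal{T}^{\top}\\ \mathcal{T} & -\alpha I_n\otimes I_m\end{bmatrix}\in\mathbb{R}^{2mn\times 2mn},\qquad \mathcal{T}=B_n\otimes I_m+\tau I_n\otimes M_m^{-1/2}K_mM_m^{-1/2},$$ and let $$|\mathcal{A}|:=\sqrt{\mathcal{A}^2}=\begin{bmatrix}\sqrt{\mathcal{T}^{\top}\mathcal{T}+\alpha^2 I_n\otimes I_m} & \\ & \sqrt{\mathcal{T}\mathcal{T}^{\top}+\alpha^2 I_n\otimes I_m}\end{bmatrix}.$$ Then the preconditioned matrix $|\mathcal{A}|^{-1}\mathcal{A}$ is both (real) symmetric and orthogonal.
   Context: Let $n\ge 2$ and $m\ge 1$ be integers, $\tau>0$, $\gamma>0$, $\alpha=\tau/\sqrt{\gamma}$, and $\theta\in[\tfrac12,1]$. $I_k$ is the $k\times k$ identity matrix and $\otimes$ is the Kronecker product. $M_m\in\mathbb{R}^{m\times m}$ is symmetric positive definite and $K_m\in\mathbb{R}^{m\times m}$ is symmetric positive semi-definite. Square roots of Hermitian positive semi-definite matrices are the unique Hermitian positive semi-definite square roots. $B_n=B_n^{(1)}(B_n^{(2)})^{-1}$, where $B_n^{(1)}$ is the $n\times n$ lower bidiagonal matrix with $1$ on the diagonal, $-1$ on the first subdiagonal and zeros elsewhere, and $B_n^{(2)}$ is the $n\times n$ lower bidiagonal matrix with $\theta$ on the diagonal, $1-\theta$ on the first subdiagonal and zeros elsewhere. *)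

(* Defs.v *)
From mathcomp Require Import all_boot all_order all_algebra.
From mathcomp Require Import boolp classical_sets reals.
From mathcomp Require Export mxtens.

Set Implicit Arguments.
Unset Strict Implicit.
Unset Printing Implicit Defensive.

Import Order.TTheory GRing.Theory Num.Theory.
Local Open Scope ring_scope.
Local Open Scope classical_set_scope.

Definition psdmx (R : realType) (k : nat) (A : 'M[R]_k) : Prop :=
  A \is symmetricmx /\ forall x : 'cV[R]_k, 0 <= (x^T *m A *m x) 0 0.

Definition pdmx (R : realType) (k : nat) (A : 'M[R]_k) : Prop :=
  A \is symmetricmx /\ forall x : 'cV[R]_k, x != 0 -> 0 < (x^T *m A *m x) 0 0.

Definition orthogonalmx (R : realType) (k : nat) (Q : 'M[R]_k) : Prop :=
  Q^T *m Q = 1%:M /\ Q *m Q^T = 1%:M.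

(* The positive semi-definite square root; the default value 0 is only reached
   when A has no such root, i.e. when A is not positive semi-definite. *)
Definition sqrtmx (R : realType) (k : nat) (A : 'M[R]_k) : 'M[R]_k :=
  xget 0 [set S : 'M[R]_k | psdmx S /\ S *m S = A].

Definition lower_bidiag (R : realType) (n : nat) (d s : R) : 'M[R]_n :=
  \matrix_(i, j) (if i == j then d
                  else if (i : nat) == (j : nat).+1 then s else 0).

Definition Bmx1 (R : realType) (n : nat) : 'M[R]_n := lower_bidiag n 1 (-1).

Definition Bmx2 (R : realType) (n : nat) (theta : R) : 'M[R]_n :=
  lower_bidiag n theta (1 - theta).

Definition Bmx (R : realType) (n : nat) (theta : R) : 'M[R]_n :=
  Bmx1 R n *m invmx (Bmx2 n theta).

(* [*t] is the Kronecker product. *)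
Definition calT (R : realType) (n m : nat) (theta tau : R) (M K : 'M[R]_m) :
    'M[R]_(n * m) :=
  Bmx n theta *t (1%:M : 'M[R]_m)
  + tau *: ((1%:M : 'M[R]_n) *t (invmx (sqrtmx M) *m K *m invmx (sqrtmx M))).

Definition calA (R : realType) (n m : nat) (alpha : R) (T : 'M[R]_(n * m)) :
    'M[R]_(n * m + n * m) :=
  let I := (1%:M : 'M[R]_n) *t (1%:M : 'M[R]_m) in
  block_mx (alpha *: I) T^T T (- (alpha *: I)).

Definition absmx (R : realType) (k : nat) (A : 'M[R]_k) : 'M[R]_k :=
  sqrtmx (A *m A).

(* Main.v *)
Require Import Defs.
From mathcomp Require Import all_boot all_order all_algebra.
From mathcomp Require Import reals.
From mathcomp Require Import classical_sets.
From mathcomp Require Import complex.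

Set Implicit Arguments.
Unset Strict Implicit.
Unset Printing Implicit Defensive.

Import Order.TTheory GRing.Theory Num.Theory.
Local Open Scope classical_set_scope.
Local Open Scope ring_scope.

(** The matrix A is symmetric and A^2 is block diagonal with diagonal blocks
T^T T + alpha^2 and T T^T + alpha^2: the off-diagonal blocks cancel because the
diagonal blocks of A are the opposite scalars alpha and - alpha. As alpha <> 0,
both blocks are positive definite, so A and |A| are invertible, and the block
diagonal matrix of the square roots is a positive semi-definite root of A^2,
hence equal to |A| ([absmx_calA]).

The other conclusions hold for every invertible symmetric A
([polar_symmetric]): |A| commutes with A, so that |A|^-1 A = A |A|^-1 is
symmetric, and it squares to |A|^-1 A^2 |A|^-1 = 1.

Two facts on positive semi-definite square roots carry this. Existence
([psd_sqrt_exists]): by the complex spectral theorem a polynomial in a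
real symmetric A depends only on its values at finitely many real eigenvalues
of A; if q interpolates the fourth root there, then q(A)^2 is a square root
of A, and it is positive semi-definite because q(A) is
symmetric. Uniqueness and commutation both follow from [sylvester_psd]: if S
and S' are positive semi-definite and S X + X S' = 0, taking the trace of
X^T S X + X^T X S' gives a sum of two nonnegative terms that vanishes, whence
S X = 0. Applied to S X - X S', it shows that an X intertwining the squares of
S and S' intertwines S and S' themselves when S is invertible
([psd_sqrt_intertwine]); X = 1 gives uniqueness, X = A and S = S' = |A| the
commutation. *)

Lemma symmetricmxP (F : fieldType) k (A : 'M[F]_k) :
  reflect (A^T = A) (A \is symmetricmx).
Proof.
rewrite is_hermitianmxE expr0 scale1r map_mx_id //.
by apply: (iffP eqP) => /esym.
Qed.

(** Newton's scheme: a new node is reached by adding a multiple of the polynomial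
that vanishes at the earlier ones, unless it is already one of them. *)
Lemma interpolation (F : fieldType) (s : seq F) (f : F -> F) :
  exists p : {poly F}, {in s, forall x, p.[x] = f x}.
Proof.
elim: s => [|x s [p ps]]; first by exists 0.
have [xs|xNs] := boolP (x \in s).
  by exists p => y; rewrite inE => /predU1P[->|]; apply: ps.
pose w := \prod_(y <- s) ('X - y%:P).
have wx : w.[x] != 0 by rewrite -rootE root_prod_XsubC.
exists (p + ((f x - p.[x]) / w.[x]) *: w) => y.
rewrite inE !hornerE => /predU1P[->|ys].
  by rewrite divfK // addrC subrK.
have /rootP -> : root w y by rewrite root_prod_XsubC.
by rewrite mulr0 addr0 ps.
Qed.

Section RealMatrices.
Variable R : realType.

Lemma trace_gram_ge0 k l (X : 'M[R]_(k, l)) : 0 <= \tr (X^T *m X).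
Proof.
apply: sumr_ge0 => j _; rewrite mxE sumr_ge0 // => i _.
by rewrite mxE -expr2 sqr_ge0.
Qed.

Lemma trace_gram_eq0 k l (X : 'M[R]_(k, l)) : \tr (X^T *m X) = 0 -> X = 0.
Proof.
move=> /eqP; rewrite psumr_eq0 => [/allP X0|j _]; last first.
  by rewrite mxE sumr_ge0 // => i _; rewrite mxE -expr2 sqr_ge0.
apply/matrixP => i j; rewrite [RHS]mxE; apply/eqP.
have := X0 j (mem_index_enum _).
rewrite mxE psumr_eq0 => [/allP/(_ i (mem_index_enum _))|i' _].
  by rewrite mxE mulf_eq0 orbb.
by rewrite mxE -expr2 sqr_ge0.
Qed.

Lemma gram_psd k l (X : 'M[R]_(l, k)) : psdmx (X^T *m X).
Proof.
split; first by apply/symmetricmxP; rewrite trmx_mul trmxK.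
move=> x; rewrite mulmxA -mulmxA -trmx_mul.
by have := trace_gram_ge0 (X *m x); rewrite trace_mx11.
Qed.

(** For an eigenvector v, the quadratic form at v^T is a times the squared norm
of v. *)
Lemma psd_eigenvalue_ge0 k (A : 'M[R]_k) a :
  psdmx A -> eigenvalue A a -> 0 <= a.
Proof.
move=> [_ A_ge0] /eigenvalueP [v vA v_neq0].
have := A_ge0 v^T; rewrite trmxK vA -scalemxAl mxE -trace_mx11.
rewrite -{1}(trmxK v) pmulr_lge0 // lt_def trace_gram_ge0 andbT.
by apply: contra_neq v_neq0 => /trace_gram_eq0/(congr1 trmx); rewrite trmxK trmx0.
Qed.

(** Over the complex numbers A is diagonalizable with real eigenvalues, and a
polynomial in A depends only on the values of the polynomial on them. Real
matrices that agree over the complex numbers are equal, which brings this back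
to real polynomials. *)
Lemma symmetric_spectrum k (A : 'M[R]_k.+1) :
  A \is symmetricmx ->
  exists2 s : seq R, {in s, forall a, eigenvalue A a}
  & forall q r : {poly R}, {in s, forall a, q.[a] = r.[a]} ->
      horner_mx A q = horner_mx A r.
Proof.
move=> /symmetricmxP Asym.
pose toC : {rmorphism R -> complex R} := real_complex R.
pose C := map_mx toC A.
have Creal : C \is a mxOver Num.real.
  apply/mxOverP => i j; rewrite mxE.
  by apply/complex_realP; exists (A i j).
have Csym : C \is symmetricmx by apply/symmetricmxP; rewrite map_trmx Asym.
have := orthomx_spectralP (symmetric_normalmx Csym Creal).
have := hermitian_spectral_diag_real (realsym_hermsym Csym Creal).
have := spectral_unit C.
move: (spectralmx C) (spectral_diag C) => P d Pu /mxOverP dreal defC.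
have dE j : d 0 j = toC (complex.Re (d 0 j)) by rewrite [RHS]RRe_real.
exists [seq complex.Re (d 0 j) | j : 'I_k.+1].
  move=> _ /mapP[j _ ->].
  (* An eigenvalue of the complexified matrix that happens to be real is a root
     of the real characteristic polynomial, hence has a real eigenvector. *)
  rewrite eigenvalue_root_char -(fmorph_root toC) map_char_poly.
  rewrite -eigenvalue_root_char -dE; apply/eigenvalueP; exists (row j P).
    by rewrite -row_mul -/C {1}defC !mulmxA mulmxV // mul1mx row_mul
       row_diag_mx -scalemxAl -rowE.
  apply/eqP => /(congr1 (mulmx^~ (invmx P))); rewrite mul0mx rowE mulmxK //.
  by move=> /rowP/(_ j)/eqP; rewrite !mxE !eqxx oner_eq0.
move=> q r qr; apply: (map_mx_inj (f := toC)); rewrite !map_horner_mx -/C defC.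
rewrite !(horner_mx_uconjC _ _ Pu) !horner_mx_diag.
apply: (congr1 (fun e => invmx P *m diag_mx e *m P)).
apply/rowP => j; rewrite !mxE dE !horner_map qr //.
by apply/mapP; exists j; rewrite // mem_enum.
Qed.

(** The fourth root is interpolated, rather than the square root, so that the
candidate is itself the square of a symmetric matrix and thus positive
semi-definite without any spectral computation. *)
Lemma psd_sqrt_exists k (A : 'M[R]_k) :
  psdmx A -> exists2 S : 'M[R]_k, psdmx S & S *m S = A.
Proof.
case: k A => [|k] A Apsd.
  (* Polynomials in a matrix need a nonzero dimension; all matrices of
     dimension 0 are equal. *)
  exists (A^T *m A); first exact: gram_psd.
  by apply/matrixP => -[].
have /symmetricmxP Asym := Apsd.1.
have [s s_eig s_horner] := symmetric_spectrum Apsd.1.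
have [q qE] := interpolation s (fun a => Num.sqrt (Num.sqrt a)).
have symq p : (horner_mx A p)^T = horner_mx A p.
  elim/poly_ind: p => [|p c IH]; first by rewrite rmorph0 trmx0.
  rewrite rmorphD rmorphM /= horner_mx_X horner_mx_C linearD /=.
  rewrite trmx_mul tr_scalar_mx IH Asym; congr (_ + _).
  exact/esym/comm_horner_mx.
exists (horner_mx A (q ^+ 2)).
  by rewrite rmorphXn /= expr2 -{1}symq; apply: gram_psd.
rewrite -[LHS]rmorphM -[RHS]horner_mx_X; apply: s_horner => a sa.
rewrite hornerM horner_exp hornerX qE // sqr_sqrtr ?sqrtr_ge0 // -expr2.
by rewrite sqr_sqrtr // (psd_eigenvalue_ge0 Apsd) // s_eig.
Qed.

(** With S = Q^2, S' = Q'^2, the traces of X^T S X and X^T X S' are the squared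
Frobenius norms of Q X and Q' X^T. Their sum is 0, so Q X = 0. *)
Lemma sylvester_psd k l (S : 'M[R]_k) (S' : 'M[R]_l) (X : 'M[R]_(k, l)) :
  psdmx S -> psdmx S' -> S *m X + X *m S' = 0 -> S *m X = 0.
Proof.
move=> /psd_sqrt_exists[Q [/symmetricmxP Qsym _] <-].
move=> /psd_sqrt_exists[Q' [/symmetricmxP Q'sym _] <-] SX.
suff /trace_gram_eq0 QX0 : \tr ((Q *m X)^T *m (Q *m X)) = 0.
  by rewrite -mulmxA QX0 mulmx0.
apply/eqP; rewrite eq_le trace_gram_ge0 andbT -[leRHS](mxtrace0 R l).
rewrite -(mulmx0 _ X^T) -SX mulmxDr linearD /= trmx_mul Qsym !mulmxA.
(* Cyclicity of the trace turns X^T X Q' Q' into the Gram matrix of Q' X^T. *)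
rewrite lerDl mxtrace_mulC !mulmxA -mulmxA.
rewrite -[X in \tr (X *m _)]trmxK trmx_mul !trmxK Q'sym.
exact: trace_gram_ge0.
Qed.

(** E = S X - X S' satisfies S E + E S' = S^2 X - X S'^2 = 0, so that S E = 0 by
[sylvester_psd]. *)
Lemma psd_sqrt_intertwine k l (S : 'M[R]_k) (S' : 'M[R]_l) (X : 'M[R]_(k, l)) :
  psdmx S -> psdmx S' -> S \in unitmx ->
  S *m S *m X = X *m (S' *m S') -> S *m X = X *m S'.
Proof.
move=> Spsd S'psd Su SSX.
have : S *m (S *m X - X *m S') = 0.
  apply: (sylvester_psd Spsd S'psd).
  by rewrite mulmxBr mulmxBl !mulmxA SSX mulmxA addrA subrK subrr.
move=> /(congr1 (mulmx (invmx S))); rewrite mulmx0 mulKmx //.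
exact: subr0_eq.
Qed.

Lemma sqrtmxP k (A : 'M[R]_k) :
  psdmx A -> psdmx (sqrtmx A) /\ sqrtmx A *m sqrtmx A = A.
Proof.
move=> /psd_sqrt_exists[S Spsd SS].
exact: (xgetPex 0 (ex_intro [set S | psdmx S /\ S *m S = A] S (conj Spsd SS))).
Qed.

Lemma sqrtmx_unique k (A S : 'M[R]_k) :
  A \in unitmx -> psdmx S -> S *m S = A -> sqrtmx A = S.
Proof.
move=> Au Spsd SSA.
have [rpsd rr] : psdmx (sqrtmx A) /\ sqrtmx A *m sqrtmx A = A.
  apply: sqrtmxP; have /symmetricmxP Ssym := Spsd.1.
  by rewrite -SSA -{1}Ssym; apply: gram_psd.
have ru : sqrtmx A \in unitmx by move: Au; rewrite -{1}rr unitmx_mul => /andP[].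
by rewrite -[LHS]mulmx1 -[RHS]mul1mx; apply: psd_sqrt_intertwine => //;
  rewrite rr SSA mulmx1 mul1mx.
Qed.

Lemma pd_unitmx k (A : 'M[R]_k) : pdmx A -> A \in unitmx.
Proof.
move=> [_ A_gt0]; rewrite unitmxE unitfE; apply/det0P => -[v v_neq0 vA0].
have /A_gt0 : v^T != 0 by rewrite -trmx0 (inj_eq trmx_inj).
by rewrite trmxK vA0 mul0mx mxE ltxx.
Qed.

Lemma pd_psd k (A : 'M[R]_k) : pdmx A -> psdmx A.
Proof.
move=> [Asym A_gt0]; split=> // x.
have [->|/A_gt0/ltW//] := eqVneq x 0; by rewrite mulmx0 mxE.
Qed.

(** The quadratic form is |X x|^2 + c |x|^2. *)
Lemma gram_shift_pd k l (X : 'M[R]_(l, k)) (c : R) :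
  0 < c -> pdmx (X^T *m X + c%:M).
Proof.
move=> c_gt0; have [/symmetricmxP Xsym X_ge0] := gram_psd X; split.
  by apply/symmetricmxP; rewrite linearD /= Xsym tr_scalar_mx.
move=> x x_neq0; rewrite mulmxDr mulmxDl mxE ltr_wpDl // mul_mx_scalar.
rewrite -scalemxAl mxE mulr_gt0 // lt_def -trace_mx11 trace_gram_ge0 andbT.
by apply: contra_neq x_neq0 => /trace_gram_eq0.
Qed.

(** The orthogonal factor of the polar decomposition of an invertible symmetric
matrix is a symmetric involution: the matrix sign of A. *)
Lemma polar_symmetric k (A : 'M[R]_k) :
  A^T = A -> A \in unitmx ->
  [/\ absmx A \in unitmx, invmx (absmx A) *m A \is symmetricmx
    & orthogonalmx (invmx (absmx A) *m A)].
Proof.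
move=> Asym Au.
have [] : psdmx (absmx A) /\ absmx A *m absmx A = A *m A.
  by apply: sqrtmxP; rewrite -{1}Asym; apply: gram_psd.
move: (absmx A) => B Bpsd BB.
have Bu : B \in unitmx.
  have AAu : A *m A \in unitmx by rewrite unitmx_mul Au.
  by move: AAu; rewrite -BB unitmx_mul => /andP[].
have BA : B *m A = A *m B.
  by apply: psd_sqrt_intertwine => //; rewrite BB mulmxA.
have /symmetricmxP Bsym := Bpsd.1.
have PE : invmx B *m A = A *m invmx B.
  by rewrite -{1}(mulmxK Bu A) -BA !mulmxA mulVmx // mul1mx.
have Psym : (invmx B *m A)^T = invmx B *m A.
  by rewrite trmx_mul trmx_inv Asym Bsym.
have PP : (invmx B *m A) *m (invmx B *m A) = 1%:M.
  by rewrite {2}PE -mulmxA (mulmxA A) -BB mulmxK // mulVmx.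
by split=> //; [apply/symmetricmxP|rewrite /orthogonalmx Psym].
Qed.

Lemma block_diag_psd k l (S : 'M[R]_k) (S' : 'M[R]_l) :
  psdmx S -> psdmx S' -> psdmx (block_mx S 0 0 S').
Proof.
move=> [/symmetricmxP Ssym S_ge0] [/symmetricmxP S'sym S'_ge0]; split.
  by apply/symmetricmxP; rewrite tr_block_mx !trmx0 Ssym S'sym.
move=> x; rewrite -[x]vsubmxK tr_col_mx mul_row_block !mulmx0 addr0 add0r.
by rewrite mul_row_col mxE addr_ge0.
Qed.

End RealMatrices.

Lemma tensmx11 (R : comNzRingType) n m :
  (1%:M : 'M[R]_n) *t (1%:M : 'M[R]_m) = 1%:M.
Proof.
apply/matrixP => i j.
case: (mxtens_indexP i) => i1 i2; case: (mxtens_indexP j) => j1 j2.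
rewrite tensmxE !mxE -natrM mulnb (inj_eq (can_inj (@mxtens_indexK _ _))).
by rewrite xpair_eqE.
Qed.

Section SaddlePoint.
Variables (R : realType) (n m : nat).
Implicit Type T : 'M[R]_(n * m).

Lemma calA_sym (alpha : R) T : (calA alpha T)^T = calA alpha T.
Proof.
by rewrite /calA tr_block_mx trmxK linearN /= linearZ /= tensmx11 trmx1.
Qed.

Lemma absmx_calA (alpha : R) T : alpha != 0 ->
  let I := (1%:M : 'M[R]_n) *t (1%:M : 'M[R]_m) in
  absmx (calA alpha T) = block_mx (sqrtmx (T^T *m T + alpha ^+ 2 *: I)) 0
                                  0 (sqrtmx (T *m T^T + alpha ^+ 2 *: I))
  /\ calA alpha T \in unitmx.
Proof.
move=> alpha_neq0 /=; rewrite tensmx11 scalemx1.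
have alpha2_gt0 : 0 < alpha ^+ 2 by rewrite exprn_even_gt0.
have A2 : calA alpha T *m calA alpha T =
    block_mx (T^T *m T + (alpha ^+ 2)%:M) 0 0 (T *m T^T + (alpha ^+ 2)%:M).
  rewrite /calA tensmx11 scalemx1 mulmx_block mulmxN mulNmx mulNmx mulmxN.
  rewrite opprK !mul_mx_scalar !mul_scalar_mx !subrr scale_scalar_mx -expr2.
  by rewrite [X in block_mx X]addrC.
have H1pd : pdmx (T^T *m T + (alpha ^+ 2)%:M) by apply: gram_shift_pd.
have H2pd : pdmx (T *m T^T + (alpha ^+ 2)%:M).
  by rewrite -{1}(trmxK T); apply: gram_shift_pd.
have [S1psd S1S1] := sqrtmxP (pd_psd H1pd).
have [S2psd S2S2] := sqrtmxP (pd_psd H2pd).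
have A2u : calA alpha T *m calA alpha T \in unitmx.
  by rewrite A2 unitmxE det_ublock unitrM -!unitmxE !pd_unitmx.
split; last by move: A2u; rewrite unitmx_mul => /andP[].
apply: sqrtmx_unique => //; first exact: block_diag_psd.
by rewrite mulmx_block !mul0mx !mulmx0 !addr0 !add0r S1S1 S2S2 A2.
Qed.

End SaddlePoint.

Theorem proposition3p2 (R : realType) (n m : nat) (tau gamma theta : R)
    (M K : 'M[R]_m) (hn : (2 <= n)%N) (hm : (1 <= m)%N)
    (htau : 0 < tau) (hgamma : 0 < gamma) (htheta : 1 / 2 <= theta <= 1)
    (hM : pdmx M) (hK : psdmx K) :
  let alpha := tau / Num.sqrt gamma in
  let I := (1%:M : 'M[R]_n) *t (1%:M : 'M[R]_m) in
  let T := calT n theta tau M K in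
  let A := calA alpha T in
  let P := invmx (absmx A) *m A in
  [/\ absmx A = block_mx (sqrtmx (T^T *m T + alpha ^+ 2 *: I)) 0
                         0 (sqrtmx (T *m T^T + alpha ^+ 2 *: I)),
      absmx A \in unitmx,
      P \is symmetricmx
    & orthogonalmx P].
Proof.
move=> alpha I T A P.
have alpha_neq0 : alpha != 0 by rewrite gt_eqF // divr_gt0 // sqrtr_gt0.
have [absAE Au] := absmx_calA T alpha_neq0.
have [absAu Psym Porth] := polar_symmetric (calA_sym alpha T) Au.
by split.
Qed.
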